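(* Let $n\ge 2$ be an integer, let $q$ be a prime power, and let $G$ be a group with $\mathrm{SL}_n(q)\le G\le \mathrm{GL}_n(q)$. Let $p_1<p_2<\cdots<p_\nu$ be the distinct prime factors of $n$, so that $\nu=\nu(n)$ is the number of distinct prime factors of $n$. Then: (1) If $\nu\ge 2$ then $$\gamma(G)\le\left(1-\frac{1}{p_1}\right)\left(1-\frac{1}{p_2}\right)\frac{n}{2}+2.$$ (2) If $n>6$ then $$\gamma(G)\le\left\lfloor\frac{n}{3}\right\rfloor+\phi(6,2,n)+\nu.$$
   Context: For a non-cyclic finite group $G$, $\gamma(G)$ denotes the least $k$ for which there exist proper subgroups $H_1,\dots,H_k<G$ with $G=\bigcup_{i=1}^k\bigcup_{g\in G}H_i^g$, i.e. the smallest number of conjugacy classes of proper subgroups needed to cover $G$. For integers $k,t,n$ with $0\le t<k<n$, Lehmer's partial totient $\phi(k,t,n)$ is the number of integers $x$ coprime with $n$ such that $\frac{nt}{k}<x<\frac{n(t+1)}{k}$. $\lfloor x\rfloor$ denotes the integer part of $x$. *)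

(* Defs.v *)
From HB Require Import structures.
From mathcomp Require Import all_boot all_order all_algebra all_fingroup.
From mathcomp Require Import all_solvable.

Set Implicit Arguments.
Unset Strict Implicit.
Unset Printing Implicit Defensive.

Import GroupScope GRing.Theory Num.Theory.

Definition normally_covered (gT : finGroupType) (G : {group gT}) (k : nat) :=
  [exists H : {ffun 'I_k -> {group gT}},
     [forall i, H i \proper G]
     && (G :==: \bigcup_(i < k) \bigcup_(g in G) (H i :^ g))].

Lemma noncyclic_normally_covered (gT : finGroupType) (G : {group gT}) :
  ~~ cyclic G -> exists k, normally_covered G k.
Proof.
move=> ncG; exists #|G|; apply/existsP.
exists [ffun i : 'I_#|G| => <[enum_val i]>%G]; apply/andP; split.
  apply/forallP => i; rewrite ffunE properEneq cycle_subG enum_valP andbT.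
  by apply: contraNneq ncG => <-; apply: cycle_cyclic.
rewrite eqEsubset; apply/andP; split.
  apply/subsetP => x Gx; apply/bigcupP; exists (enum_rank_in Gx x) => //.
  apply/bigcupP; exists 1 => //.
  by rewrite conjsg1 ffunE enum_rankK_in //= cycle_id.
apply/bigcupsP => i _; apply/bigcupsP => g Gg.
by rewrite ffunE sub_conjg conjGid ?groupV //= cycle_subG enum_valP.
Qed.

(* As no finite cyclic group is a union of conjugates of proper subgroups,
   the argument ncG is needed for the minimum to exist. *)
Definition gamma (gT : finGroupType) (G : {group gT}) (ncG : ~~ cyclic G) :
  nat := ex_minn (noncyclic_normally_covered ncG).

(* 'I_n loses no integer: the bounds lie between 0 and n when t < k, and the
   inequalities are strict. *)
Definition lehmer_totient (k t n : nat) : nat :=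
  #|[set x : 'I_n | coprime x n &
      (n%:R * t%:R / k%:R < x%:R :> rat)%R &&
      (x%:R < n%:R * t.+1%:R / k%:R :> rat)%R]|.

Definition SL (n : nat) (F : finFieldType) : {set {'GL_n[F]}} :=
  [set u : {'GL_n[F]} | (\det (GLval u) == 1)%R].

Lemma SL_group_set (n : nat) (F : finFieldType) : group_set (SL n F).
Proof.
apply/group_setP; split; first by rewrite inE GL_1E det1.
move=> u v; rewrite !inE => /eqP du /eqP dv.
by rewrite GL_MxE det_mulmx du dv mulr1.
Qed.
Canonical SL_group (n : nat) (F : finFieldType) := Group (SL_group_set n F).

Lemma SL_overgroup_noncyclic (n : nat) (F : finFieldType)
    (G : {group {'GL_n[F]}}) :
  (1 < n)%N -> SL n F \subset G -> ~~ cyclic G.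
Proof.
move=> n_gt1 sSG; apply/negP => /cyclic_abelian/centsP abG.
have n1_gt0 : (0 < n.-1)%N by case: n n_gt1 {G sSG abG} => [|[]].
pose E (i j : 'I_n.-1.+1) : 'M[F]_n.-1.+1 := (1%:M + delta_mx i j)%R.
have dE : (\det (E ord_max ord0) = 1)%R.
  rewrite det_trig; last first.
    apply/is_trig_mxP => i j lt_ij.
    rewrite !mxE -val_eqE (ltn_eqF lt_ij) add0r.
    case: (altP (i =P ord_max)) lt_ij => [->|] //=.
    by rewrite ltnNge -ltnS ltn_ord.
  apply: big1 => i _; rewrite !mxE eqxx.
  case: (altP (i =P ord_max)) => [->|_] /=; last by rewrite addr0.
  by rewrite -val_eqE /= eqn0Ngt n1_gt0 addr0.
have dE' : (\det (E ord0 ord_max) = 1)%R.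
  by rewrite -det_tr /E linearD /= trmx1 trmx_delta.
have uE : E ord_max ord0 \in unitmx by rewrite unitmxE dE unitr1.
have uE' : E ord0 ord_max \in unitmx by rewrite unitmxE dE' unitr1.
pose u : {'GL_n[F]} := Sub (E ord_max ord0) uE.
pose v : {'GL_n[F]} := Sub (E ord0 ord_max) uE'.
have Gu : u \in G by rewrite (subsetP sSG) // inE SubK dE.
have Gv : v \in G by rewrite (subsetP sSG) // inE SubK dE'.
have := congr1 (fun w : {'GL_n[F]} => GLval w ord0 ord0) (abG u Gu v Gv).
have ne : (@ord0 n.-1 == ord_max) = false.
  by rewrite -val_eqE /= eq_sym eqn0Ngt n1_gt0.
rewrite !GL_MxE !SubK /E !mulmxDl !mulmxDr !mul1mx !mulmx1 !mul_delta_mx !mxE.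
rewrite ne !eqxx /= !addr0 => /eqP.
by rewrite add0r -subr_eq0 opprD addrA subrr add0r oppr_eq0 oner_eq0.
Qed.

(* Main.v *)
Require Import Defs.
From mathcomp Require Import all_boot all_order all_algebra all_fingroup.
From mathcomp Require Import all_solvable all_field zify ring lra.

Set Implicit Arguments.
Unset Strict Implicit.
Unset Printing Implicit Defensive.

Import Order.TTheory GRing.Theory Num.Theory.

(** Two kinds of proper subgroups of G, each forming a single class under
    conjugation by SL_n(q), suffice to cover G.

    - For 0 < k < n, the stabiliser of a k-dimensional subspace. A matrix with
      characteristic polynomial chi leaves invariant a subspace of dimension
      deg h for every divisor h of chi ([stable_dvd_char_poly]). Replacing h by
      chi / h exchanges k and n - k, so that one class serves both dimensions
      ([class_covered_stabiliser]).

    - For p > 1, the centraliser of a subfield of order q^p of the matrix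
      algebra. When p divides the degree of every irreducible factor of chi,
      the algebra F[x] generated by x contains such a subfield: if P is
      irreducible of degree p, then P has a root modulo each factor, and these
      roots lift and glue to a polynomial h with P(h(x)) = 0
      ([comp_poly_root_mod]). All matrices A with P(A) = 0 are conjugate under
      SL_n(q) ([mx_roots_conj_det]), since they are similar and P can be
      chosen with a norm that generates the multiplicative group of F, which
      makes the determinant onto on the centraliser of A
      ([class_covered_centraliser]).

    By [gamma_le_degrees] the theorem reduces to arithmetic of the degrees of
    the factors of a polynomial chi of degree n. For the first bound, use the
    fields of degrees p1 and p2, and the dimensions k < n / 2 coprime to p1 p2.
    If some factor of chi has degree prime to p1 and some factor has degree
    prime to p2, then one of them or their product has degree prime to p1 p2
    ([coprime_divisor]); counting by symmetry gives
    (1 - 1 / p1) (1 - 1 / p2) n / 2 dimensions.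

    For the second bound, use the fields of degree p for each prime p dividing
    n, the dimensions k <= n / 3, and the dimensions k coprime to n with
    n / 3 < k < n / 2. If chi has no divisor of degree between 1 and n / 3, it
    has at most two irreducible factors, counted with multiplicity. If chi is
    irreducible, any prime dividing n works; if the two degrees d and n - d are
    not coprime to n, a common prime factor of d and n divides both of them, and
    otherwise the smaller one is one of the chosen dimensions
    ([small_or_coprime_divisor]). *)

(** * Polynomials over finite fields *)

Section Polynomials.
Local Open Scope ring_scope.

Variable F : finFieldType.
Implicit Types f g h P : {poly F}.
Local Notation q := #|F|.

Lemma irreducible_factor g :
  (1 < size g)%N -> exists2 f, irreducible_poly f & f %| g.
Proof.
have [n] := ubnP (size g); elim: n g => // n IHn g le_g_n g_gt1.
have [irr_g | /irreducibleP red_g] := irreducibleP g; first by exists g.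
move: red_g; rewrite /irreducibleb g_gt1 /= => /forallPn[d].
rewrite negb_imply -Pdiv.Idomain.dvdpE -ltnNge => /andP[d_dv_g d_gt1].
have le_d_g := size_npoly d.
have [] := IHn d _ d_gt1.
  by apply: leq_ltn_trans le_d_g _; rewrite -ltnS prednK // ltnW.
by move=> f irr_f f_dv_d; exists f => //; apply: dvdp_trans d_dv_g.
Qed.

Lemma irreducible_dvdpM f g h :
  irreducible_poly f -> (f %| g * h) = (f %| g) || (f %| h).
Proof.
move=> irr_f; apply/idP/orP => [|[]]; [|exact: dvdp_mulr|exact: dvdp_mull].
have [|ndv] := boolP (f %| g); first by left.
by rewrite Gauss_dvdpr ?irreducible_poly_coprime //; right.
Qed.

Lemma irreducible_root_dvdp (K : fieldType) (iota : {rmorphism F -> K}) f g a :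
    irreducible_poly f -> root (map_poly iota f) a ->
  root (map_poly iota g) a = (f %| g).
Proof.
move=> irr_f fa0; apply/idP/idP => [|f_dv_g]; last first.
  by apply: root_dvdp fa0; rewrite dvdp_map.
apply: contraLR; rewrite -irreducible_poly_coprime // => co_fg.
by apply: (@coprimep_root _ (map_poly iota f)); rewrite ?coprimep_map.
Qed.

Lemma irreducible_with_root (K : fieldType) (iota : {rmorphism F -> K}) g a :
    g != 0 -> root (map_poly iota g) a ->
  exists2 f, irreducible_poly f & root (map_poly iota f) a.
Proof.
have [n] := ubnP (size g); elim: n g => // n IHn g le_g_n nz_g ga0.
have g_gt1: (1 < size g)%N.
  by rewrite -(size_map_poly iota) (root_size_gt1 _ ga0) ?map_poly_eq0.
have [f irr_f /dvdpP[h Dg]] := irreducible_factor g_gt1.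
have [f_gt1 _] := irr_f.
move: ga0 nz_g; rewrite Dg rmorphM rootM mulf_eq0 negb_or.
case/orP=> [ha0 /andP[nz_h nz_f] | fa0 _]; last by exists f.
apply: IHn ha0 => //; rewrite Dg size_mul // in le_g_n.
by move: (size _) (size f) le_g_n f_gt1; clear; lia.
Qed.

Lemma irreducible_monic f : irreducible_poly f ->
  exists g, [/\ irreducible_poly g, g \is monic & g %= f].
Proof.
move=> irr_f; have nz_f : lead_coef f != 0 by rewrite lead_coef_eq0 irredp_neq0.
exists ((lead_coef f)^-1 *: f); set g := _ *: f.
have eqgf : g %= f by apply: eqp_scale; rewrite invr_eq0.
split=> //; last by rewrite monicE lead_coefZ mulVf.
have [f_gt1 div_f] := irr_f; split=> [|d d1 d_dv].
  by rewrite (eqp_size eqgf).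
by rewrite (eqp_rtrans eqgf) div_f // -(eqp_dvdr _ eqgf).
Qed.

(** The field F[X]/(f), with its cardinality and as a finite field, in a form
    that hides the structure of extension of F. *)
Lemma root_field f : irreducible_poly f ->
  exists (K : finFieldType) (iota : {rmorphism F -> K}) (a : K),
  [/\ #|K| = (q ^ (size f).-1)%N, root (map_poly iota f) a
    & forall b, exists h, b = (map_poly iota h).[a]].
Proof.
move=> irr_f; have [L dimL [a fa0 defL]] := irredp_FAdjoin irr_f.
exists (FinFieldExtType L), (in_alg L), a; split=> //.
  rewrite -dimL -(@card_vspace F (FinFieldExtType L)).
  by apply: eq_card => x; rewrite memvf.
by move=> b; apply/Fadjoin1_polyP; rewrite defL memvf.
Qed.

(** Raising to the power q is a ring endomorphism in characteristic dividing q
    and fixes the coefficients, which lie in F. *)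
Lemma horner_Frobenius (R : comNzRingType) (iota : {rmorphism F -> R}) h x :
  (map_poly iota h).[x ^+ q] = (map_poly iota h).[x] ^+ q.
Proof.
have [l l_pr charF] := finPcharP F.
have qR: [pchar R].-nat q.
  have := pprimeChar_pgroup charF; rewrite /pgroup cardsT.
  by apply: sub_in_pnat => m _ /eqP->; apply: rmorph_pchar charF.
elim/poly_ind: h => [|h c IHh].
  by rewrite rmorph0 !horner0 expr0n; case: q (finNzRing_gt1 F).
rewrite rmorphD rmorphM /= map_polyX map_polyC !hornerE IHh exprDn_pchar //.
by rewrite exprMn -!rmorphXn expf_card.
Qed.

Lemma horner_Frobenius_iter (R : comNzRingType) (iota : {rmorphism F -> R})
    h x k :
  (map_poly iota h).[x ^+ (q ^ k)] = (map_poly iota h).[x] ^+ (q ^ k).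
Proof.
elim: k => [|k IHk]; first by rewrite expn0 !expr1.
by rewrite expnSr !exprM horner_Frobenius IHk.
Qed.

Lemma comp_poly_Frobenius P h : P \Po (h ^+ q) = (P \Po h) ^+ q.
Proof. exact: (horner_Frobenius (@polyC F)). Qed.

(** In F[X]/(f), of order q^d with d = deg f, every element is fixed by the
    d-th iterate of Frobenius, hence by its multiples. *)
Lemma irreducible_dvd_Xqn f k :
  irreducible_poly f -> f %| 'X^(q ^ ((size f).-1 * k)) - 'X.
Proof.
move=> irr_f; have [K [iota [a [cardK fa0 _]]]] := root_field irr_f.
rewrite -(irreducible_root_dvdp _ irr_f fa0).
rewrite rmorphB /= map_polyXn map_polyX /root !hornerE subr_eq0 expnM -cardK.
apply/eqP; elim: k => [|k IHk]; first by rewrite expn0 expr1.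
by rewrite expnSr exprM IHk expf_card.
Qed.

(** A finite field of order q^d contains the subfield of order q^e for every e
    dividing d. Concretely, P divides X^(q^d) - X, whose roots are all the
    elements of F[X]/(f); a root of P in that quotient is the class of h. *)
Lemma irreducible_root_mod P f :
    irreducible_poly P -> irreducible_poly f ->
    ((size P).-1 %| (size f).-1)%N ->
  exists h, f %| P \Po h.
Proof.
move=> irr_P irr_f /dvdnP[k Dsf].
have [K [iota [a [cardK fa0 genK]]]] := root_field irr_f.
have P_dv: map_poly iota P %| \prod_(x : K) ('X - x%:P).
  rewrite -finField_genPoly cardK Dsf mulnC -[X in _ - X](map_polyX iota).
  by rewrite -(map_polyXn iota) -rmorphB dvdp_map irreducible_dvd_Xqn.
have [m eqP] := dvdp_prod_XsubC P_dv.
have [b Pb0]: exists b, root (map_poly iota P) b.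
  have := eqp_size eqP; rewrite size_map_poly.
  case: (mask m _) eqP => [|b s] eqP sP; last first.
    by exists b; rewrite (eqp_root eqP) big_cons rootM root_XsubC eqxx.
  by have [] := irr_P; rewrite sP big_nil size_poly1.
have [h Db] := genK b; exists h.
rewrite -(irreducible_root_dvdp _ irr_f fa0) map_comp_poly /root.
by rewrite horner_comp -Db.
Qed.

(** The minimal polynomial of a generator w of the multiplicative group of the
    field of order q^p has the roots w^(q^i) for i < p. The determinant of its
    companion matrix is their product, the norm w^((q^p - 1) / (q - 1)), which
    has order q - 1 and so generates the multiplicative group of F. *)
Lemma irreducible_norm_generator p : (0 < p)%N ->
  exists P, [/\ irreducible_poly P, P \is monic, size P = p.+1
    & forall d : F, d != 0 -> exists j, d = \det (companionmx P) ^+ j].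
Proof.
move=> p_gt0; have q_gt1 : (1 < q)%N := finNzRing_gt1 F.
have qp_gt1 : (1 < q ^ p)%N by rewrite -(exp1n p) ltn_exp2r.
pose N := (q ^ p).-1.
have DN : N.+1 = (q ^ p)%N by rewrite prednK // ltnW.
have N_gt0 : (0 < N)%N by rewrite -ltnS DN.
have monU : 'X^N - 1 \is @monic F by apply: monicXnsubC.
have /FinSplittingFieldFor[L [zs Dzs _]] := monic_neq0 monU.
rewrite rmorphB rmorph1 /= map_polyXn in Dzs.
pose incl := in_alg L.
have q0 : q%:R = 0 :> L.
  have [l l_pr charF] := finPcharP F; rewrite (card_pprimeChar charF) natrX.
  have nz : (logn l #|F| > 0)%N.
    rewrite lt0n; apply: contraTneq q_gt1 => l0.
    by rewrite (card_pprimeChar charF) l0.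
  by rewrite (pcharf0 (rmorph_pchar incl charF)) expr0n; case: (logn l _) nz.
have N_neq0 : N%:R != 0 :> L.
  rewrite /N -subn1 natrB ?expn_gt0 ?(ltnW q_gt1) // natrX q0 expr0n.
  by rewrite gtn_eqF // sub0r oppr_eq0 oner_eq0.
have Uzs : uniq zs.
  rewrite -separable_prod_XsubC -(eqp_separable Dzs).
  exact: cyclotomic.separable_Xn_sub_1.
have szs : size zs = N.
  have := eqp_size Dzs; rewrite size_prod_XsubC size_XnsubC //.
  by case.
have /hasP[w _ prim_w] : has N.-primitive_root zs.
  apply: has_prim_root; rewrite ?szs //; apply/allP=> z zs_z.
  by rewrite /root_of_unity (eqp_root Dzs) root_prod_XsubC.
(* w lives in a splitting field of X^N - 1 that may a priori be larger than the
   field of order q^p; only its minimal polynomial over F matters. *)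
have [P0 irr_P0 P0w0] :
    exists2 f, irreducible_poly f & root (map_poly incl f) w.
  apply: (@irreducible_with_root _ _ ('X^N - 1)); first exact: monic_neq0.
  rewrite rmorphB rmorph1 /= map_polyXn.
  by rewrite /root !hornerE prim_expr_order ?subrr.
have [P [irr_P monP eqPP0]] := irreducible_monic irr_P0.
have Pw0 : root (map_poly incl P) w.
  by rewrite (eqp_root (_ : _ %= map_poly incl P0)) ?eqp_map.
have w_qp : w ^+ (q ^ p) = w.
  by rewrite -DN exprS (prim_expr_order prim_w) mulr1.
(* With d = deg P, all q^d elements of the field F[X]/(P) are roots of
   X^(q^p) - X, because the class of X is and Frobenius is a morphism. *)
have sP_le : ((size P).-1 <= p)%N.
  have [K [kappa [a [cardK Pa0 genK]]]] := root_field irr_P.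
  have a_qp : a ^+ (q ^ p) = a.
    apply/eqP; rewrite -subr_eq0.
    have := irreducible_root_dvdp ('X^(q ^ p) - 'X) irr_P Pa0.
    rewrite -(irreducible_root_dvdp _ irr_P Pw0).
    rewrite !rmorphB /= !map_polyXn !map_polyX /root !hornerE.
    by rewrite w_qp subrr eqxx.
  have nzU : 'X^(q ^ p) - 'X != 0 :> {poly K}.
    by rewrite -size_poly_eq0 size_polyDl size_polyXn ?size_polyN ?size_polyX.
  have := max_poly_roots nzU (_ : all _ (enum K)) (enum_uniq K).
  rewrite size_polyDl size_polyXn ?size_polyN ?size_polyX // ltnS.
  rewrite -cardE cardK leq_exp2l //; apply.
  apply/allP=> b _; have [h ->] := genK b.
  by rewrite /root !hornerE -horner_Frobenius_iter a_qp subrr.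
pose ws := [seq w ^+ (q ^ i) | i <- iota 0 p].
have Uws : uniq ws.
  rewrite map_inj_in_uniq ?iota_uniq // => i j.
  rewrite !mem_iota !add0n !leq0n /= => lt_i lt_j /eqP.
  wlog le_ij : i j lt_i lt_j / (i <= j)%N => [wl e|].
    case/orP: (leq_total i j) => le; [|apply: esym]; apply: wl => //.
    by rewrite eq_sym.
  rewrite eq_sym (eq_prim_root_expr prim_w) eqn_mod_dvd ?leq_exp2l // => N_dv.
  have lt_jp : (q ^ j < q ^ p)%N by rewrite ltn_exp2l.
  have qi_gt0 : (0 < q ^ i)%N by rewrite expn_gt0 ltnW.
  have qj_gt0 : (0 < q ^ j)%N by rewrite expn_gt0 ltnW.
  apply/eqP; rewrite eqn_leq le_ij -(leq_exp2l _ _ q_gt1) -subn_eq0.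
  apply: contraLR N_dv; rewrite -lt0n => d_gt0.
  rewrite gtnNdvd // /N; move: lt_jp qi_gt0 qj_gt0; clear.
  by move: (q ^ j)%N (q ^ i)%N (q ^ p)%N; clear; lia.
have ws0 : all (root (map_poly incl P)) ws.
  apply/allP=> _ /mapP[i _ ->]; rewrite /root horner_Frobenius_iter (eqP Pw0).
  by rewrite expr0n expn_eq0 gtn_eqF // ltnW.
have sws : size ws = p by rewrite size_map size_iota.
have sP : size P = p.+1.
  have nzPL : map_poly incl P != 0 by rewrite map_poly_eq0 irredp_neq0.
  have := max_poly_roots nzPL ws0 Uws; rewrite size_map_poly sws => lt_p.
  by apply/eqP; rewrite eqn_leq lt_p andbT -ltnS; case: (size P) lt_p sP_le.
exists P; split=> // d nz_d.
have DP : map_poly incl P = \prod_(z <- ws) ('X - z%:P).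
  rewrite [LHS](@all_roots_prod_XsubC _ _ ws) ?uniq_rootsE //; last first.
    by rewrite size_map_poly sP sws.
  by rewrite lead_coef_map (monicP monP) rmorph1 scale1r.
pose S := (\sum_(i < p) q ^ i)%N.
have DS : N = (q.-1 * S)%N by rewrite /N predn_exp.
have Ddet : incl (\det (companionmx P)) = w ^+ S.
  have := char_poly_det (companionmx P); rewrite companionmxK // => DP0.
  have -> : \det (companionmx P) = (-1) ^+ (size P).-1 * P`_0.
    by rewrite DP0 mulrA -exprMn mulrNN mulr1 expr1n mul1r.
  rewrite [LHS]rmorphM sP rmorphXn rmorphN1 -coef_map /= -horner_coef0 DP.
  rewrite horner_prod big_map (eq_bigr (fun i => - (w ^+ (q ^ i)))) => [|i _].
    have -> : iota 0 p = index_iota 0 p by rewrite /index_iota subn0.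
    rewrite big_mkord prodrN card_ord mulrA -exprMn mulrNN mulr1 expr1n mul1r.
    by rewrite prodrXr.
  by rewrite !hornerE.
have prim_det : q.-1.-primitive_root (\det (companionmx P)).
  rewrite -(fmorph_primitive_root incl) [X in _.-primitive_root X]Ddet.
  have -> : S = (N %/ q.-1)%N by rewrite DS mulKn // -ltnS prednK // ltnW.
  by apply: dvdn_prim_root prim_w _ _; rewrite DS dvdn_mulr.
have d1 : d ^+ q.-1 = 1.
  apply: (mulfI nz_d); rewrite -exprS prednK ?(ltnW q_gt1) //.
  by rewrite expf_card mulr1.
by have [j ->] := prim_rootP prim_det d1; exists j.
Qed.

Lemma dvdp_comp_polyB P g h : g - h %| (P \Po g) - (P \Po h).
Proof.
elim/poly_ind: P => [|P c IHP]; first by rewrite !comp_poly0 subrr.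
rewrite !comp_polyD !comp_polyM !comp_polyX !comp_polyC opprD addrACA subrr.
rewrite addr0.
have -> : (P \Po g) * g - (P \Po h) * h
    = ((P \Po g) - (P \Po h)) * g + (P \Po h) * (g - h).
  by rewrite mulrBl mulrBr addrA subrK.
by apply: dvdp_add; [apply: dvdp_mulr | apply: dvdp_mull].
Qed.

(** Peel off one irreducible factor f of g = c f. If f is coprime to c, a root
    modulo f and a root modulo c combine by the Chinese remainder theorem. If
    f divides c, then g divides c^2, and since P commutes with Frobenius the
    q-th power of a root modulo c is a root modulo c^q; this plays the role of
    Hensel lifting. *)
Lemma comp_poly_root_mod P g :
    irreducible_poly P -> g != 0 ->
    (forall f, irreducible_poly f -> f %| g ->
      ((size P).-1 %| (size f).-1)%N) ->
  exists h, g %| P \Po h.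
Proof.
move=> irr_P; have [n] := ubnP (size g).
elim: n g => // n IHn g le_g_n nz_g dvd_deg.
have [g_le1 | g_gt1] := leqP (size g) 1.
  exists 0; rewrite (eqp_dvdl _ (_ : g %= 1)) ?dvd1p //.
  by rewrite -size_poly_eq1 eqn_leq g_le1 size_poly_gt0.
have [f irr_f /dvdpP[c Dg]] := irreducible_factor g_gt1.
have [f_gt1 _] := irr_f.
have [nz_c nz_f] : c != 0 /\ f != 0.
  by apply/andP; rewrite -negb_or -mulf_eq0 -Dg.
have [|e irr_e e_dv|hc c_dv] := IHn c _ nz_c.
- rewrite Dg size_mul // in le_g_n.
  by move: (size c) (size f) le_g_n f_gt1; clear; lia.
- by apply: dvd_deg; rewrite // Dg dvdp_mulr.
rewrite Dg.
have [f_dv_c | co_fc] := boolP (f %| c).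
  exists (hc ^+ #|F|); rewrite comp_poly_Frobenius.
  apply: dvdp_trans (dvdp_exp2l _ (finNzRing_gt1 F)).
  by rewrite dvdp_mul // (dvdp_trans f_dv_c).
rewrite -irreducible_poly_coprime // in co_fc.
have [|hf f_dv] := irreducible_root_mod irr_P irr_f.
  by apply: dvd_deg; rewrite // Dg dvdp_mull.
have [[u v] /= Duv] := Bezout_eq1_coprimepP _ _ co_fc.
exists (hc * (u * f) + hf * (v * c)).
rewrite Gauss_dvdp 1?coprimep_sym //; apply/andP; split.
  rewrite -[X in _ %| X](subrK (P \Po hc)) dvdp_add //.
  apply: dvdp_trans (dvdp_comp_polyB _ _ _).
  rewrite -[X in _ - X]mulr1 -Duv mulrDr opprD addrACA subrr add0r -mulrBl.
  by rewrite !dvdp_mull.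
rewrite -[X in _ %| X](subrK (P \Po hf)) dvdp_add //.
apply: dvdp_trans (dvdp_comp_polyB _ _ _).
rewrite -[X in _ - X]mulr1 -Duv mulrDr opprD addrACA subrr addr0 -mulrBl.
by rewrite !dvdp_mull.
Qed.

End Polynomials.

(** * Invariant subspaces and divisors of the characteristic polynomial *)

Section Matrices.
Local Open Scope ring_scope.

Lemma char_poly_intertwine (R : fieldType) n (A B X : 'M[R]_n) :
  X \in unitmx -> X *m A = B *m X -> char_poly A = char_poly B.
Proof.
move=> uX eqXA; pose X' := map_mx polyC X.
have dX : \det X' != 0.
  by rewrite det_map_mx polyC_eq0 -unitfE -unitmxE.
apply: (mulfI dX); rewrite -det_mulmx mulrC -det_mulmx; congr (\det _).
rewrite /char_poly_mx mulmxBr mulmxBl -!map_mxM eqXA; congr (_ - _).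
by rewrite scalar_mxC.
Qed.

Lemma char_poly_lblock (R : comNzRingType) m n (A : 'M[R]_m) B (C : 'M[R]_n) :
  char_poly (block_mx A 0 B C) = char_poly A * char_poly C.
Proof.
rewrite /char_poly /char_poly_mx map_block_mx map_mx0 scalar_mx_block.
by rewrite opp_block_mx add_block_mx !sub0r oppr0 det_lblock.
Qed.

Lemma horner_mx_comp (R : comNzRingType) n (A : 'M[R]_n.+1) (p r : {poly R}) :
  horner_mx A (p \Po r) = horner_mx (horner_mx A r) p.
Proof.
elim/poly_ind: p => [|p c IHp]; first by rewrite comp_poly0 !rmorph0.
rewrite comp_polyD comp_polyM comp_polyX comp_polyC !rmorphD !rmorphM /= IHp.
by rewrite horner_mx_X !horner_mx_C.
Qed.

Lemma row_free_complement (K : fieldType) m n (U : 'M[K]_(m, m + n)) :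
  row_free U -> exists C : 'M_(n, m + n), col_mx U C \in unitmx.
Proof.
move=> /eqP rU; exists (row_mx 0 1%:M *m row_ebase U).
have -> : col_mx U (row_mx 0 1%:M *m row_ebase U)
    = block_mx (col_ebase U) 0 0 1%:M *m row_ebase U.
  rewrite -[X in col_mx X](mulmx_ebase U) rU -mul_col_mx; congr (_ *m _).
  by rewrite pid_mx_row mul_mx_row mulmx1 mulmx0.
rewrite unitmx_mul row_ebase_unit andbT unitmxE det_lblock det1 mulr1 -unitmxE.
exact: col_ebase_unit.
Qed.

(** In a basis extending that of the invariant subspace U, the matrix A becomes
    block triangular, and C is its action on the quotient by U. The subspace W
    is the preimage of the subspace W' of that quotient. *)
Lemma quotient_stable (K : fieldType) d n
    (A : 'M[K]_n) (U : 'M_(d, n)) (B : 'M_d) :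
    row_free U -> U *m A = B *m U ->
  exists s (C : 'M_s), char_poly A = char_poly B * char_poly C
    /\ (forall W' : 'M_s, (W' *m C <= W')%MS ->
         exists W : 'M_n, (W *m A <= W)%MS /\ \rank W = (d + \rank W')%N).
Proof.
move=> freeU UA; exists (n - d)%N.
have Dn : n = (d + (n - d))%N by rewrite subnKC // -{1}(eqP freeU) rank_leq_col.
move: (n - d)%N Dn => s Dn; subst n.
have [C uT] := row_free_complement freeU.
set T := col_mx U C in uT; pose A' := T *m A *m invmx T.
have TA : T *m A = A' *m T by rewrite mulmxKV.
have A'u : usubmx A' = row_mx B 0.
  apply: (row_free_inj (_ : row_free T)); first by rewrite row_free_unit.
  by rewrite mul_usub_mx -TA mul_row_col mul0mx addr0 -UA -mul_usub_mx col_mxKu.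
pose L := lsubmx (dsubmx A'); pose D := rsubmx (dsubmx A').
have DA' : A' = block_mx B 0 L D.
  by rewrite -[A']vsubmxK A'u -[dsubmx A']hsubmxK.
exists D; split.
  by rewrite (char_poly_intertwine uT TA) DA' char_poly_lblock.
move=> W' /submxP[X W'D]; exists (block_mx 1%:M 0 0 W' *m T); split.
  rewrite -mulmxA TA DA' !mulmxA mulmx_block !mul1mx !mul0mx !addr0 !add0r W'D.
  have -> : block_mx B 0 (W' *m L) (X *m W')
      = block_mx B 0 (W' *m L) X *m block_mx 1%:M 0 0 W'.
    by rewrite mulmx_block !mulmx1 !mulmx0 !mul0mx !addr0 !add0r.
  by rewrite -mulmxA submxMl.
by rewrite mxrankMfree ?row_free_unit // rank_diag_block_mx mxrank1.
Qed.

Section Krylov.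

Variables (K : fieldType) (n : nat) (A : 'M[K]_n.+1).

(** The first d vectors of the orbit of v under A; they span the cyclic
    submodule generated by v as soon as v is killed by f(A) with deg f = d. *)
Definition krylov (v : 'rV[K]_n.+1) d : 'M[K]_(d, n.+1) :=
  \matrix_(i < d) (v *m A ^+ i).

Lemma mul_krylov v d (u : 'rV_d) :
  u *m krylov v d = v *m horner_mx A (rVpoly u).
Proof.
rewrite mulmx_sum_row {2}[u]row_sum_delta !raddf_sum /=.
apply: eq_bigr => i _; rewrite rowK linearZ /= rVpoly_delta linearZ /=.
by rewrite rmorphXn /= horner_mx_X -scalemxAr.
Qed.

Lemma krylov_companion v (f : {poly K}) (d := (size f).-1) :
    f \is monic -> v *m horner_mx A f = 0 ->
  krylov v d *m A = companionmx f *m krylov v d.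
Proof.
move=> monf vf0; apply/row_matrixP=> i; rewrite !row_mul rowK.
have sf : d.+1 = size f by rewrite prednK // size_poly_gt0 monic_neq0.
have [lt_i | ge_i] := ltnP i.+1 d.
  rewrite [row i (companionmx f)]rowE (mulmx_delta_companion lt_i) -rowE rowK.
  by rewrite -mulmxA mulmxE -exprSr.
have Di : d = i.+1 by apply/eqP; rewrite eqn_leq ge_i ltn_ord.
have Di1 : i == d.-1 :> nat.
  by apply/eqP/succn_inj; rewrite -Di prednK // (leq_ltn_trans _ (ltn_ord i)).
(* For the last row, the combination of the vectors v A^j given by the
   coefficients of X^d - f is v A^d, as f(A) kills v. *)
have -> : row i (companionmx f) = poly_rV ('X^d - f).
  apply/rowP=> j; rewrite !mxE coefB coefXn -/d Di1.
  by rewrite ltn_eqF ?ltn_ord // sub0r.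
have size_le : (size ('X^d - f)%R <= d)%N.
  apply/leq_sizeP=> j; rewrite leq_eqVlt => /predU1P[<- | lt_dj].
    by rewrite coefB coefXn eqxx -[f`_d]/(lead_coef f) (monicP monf) subrr.
  by rewrite coefB coefXn gtn_eqF // nth_default ?subrr // -sf.
rewrite mul_krylov poly_rV_K // rmorphB /= mulmxBr vf0 subr0 rmorphXn /=.
by rewrite horner_mx_X -mulmxA mulmxE -exprSr -Di.
Qed.

(** The cyclic submodule generated by v is K[X]/(f), which is simple: it meets
    the invariant subspace U trivially unless U contains v. *)
Lemma row_free_krylov r (U : 'M[K]_(r, n.+1)) v (f : {poly K}) :
    irreducible_poly f -> v *m horner_mx A f = 0 ->
    row_free U -> (U *m A <= U)%MS -> ~~ (v <= U)%MS ->
  row_free (col_mx U (krylov v (size f).-1)).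
Proof.
move=> irr_f vf0 freeU stabU notUv; apply: inj_row_free => u.
rewrite -[u]hsubmxK mul_row_col mul_krylov.
set u1 := lsubmx u; set u2 := rsubmx u; set h := rVpoly u2 => eq0.
have vh : (v *m horner_mx A h <= U)%MS.
  rewrite -(addrK (u1 *m U) (v *m _)) [_ + u1 *m U]addrC eq0 sub0r.
  by rewrite eqmx_opp submxMl.
have h0 : h = 0.
  apply: contraNeq notUv => nz_h.
  have : coprimep f h.
    rewrite irreducible_poly_coprime // gtNdvdp //.
    have [f_gt1 _] := irr_f.
    by rewrite -[X in (_ < X)%N]prednK ?(ltnW f_gt1) // ltnS size_poly.
  case/Bezout_eq1_coprimepP=> [[a b] /= Dab].
  have -> : v = v *m horner_mx A h *m horner_mx A b.
    have {1}-> : v = v *m horner_mx A 1 by rewrite rmorph1 mulmx1.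
    rewrite -Dab rmorphD mulmxDr [a * f]mulrC [b * h]mulrC !rmorphM /=.
    by rewrite !mulmxA vf0 mul0mx add0r.
  apply: submx_trans (submxMr _ vh) _.
  have stabgU : stablemx <<U>>%MS A by rewrite !(eqmxMr _ (genmxE U)) genmxE.
  by rewrite -(eqmxMr _ (genmxE U)) -(genmxE U) horner_mx_stable.
have u20 : u2 = 0 by rewrite -[u2]rVpolyK -/h h0 raddf0.
move: eq0; rewrite h0 rmorph0 mulmx0 addr0 u20 => u1U.
have -> : u1 = 0 by apply: (row_free_inj freeU); rewrite mul0mx.
by rewrite row_mx0.
Qed.

End Krylov.

Variable F : finFieldType.

(** In F[X]/(f) the polynomial f has a root, which is an eigenvalue of A; hence
    f(A) is singular over the extension, and so over F. *)
Lemma irreducible_ker_neq0 n (A : 'M[F]_n.+1) (f : {poly F}) :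
    irreducible_poly f -> f %| char_poly A ->
  exists2 v : 'rV_n.+1, v != 0 & v *m horner_mx A f = 0.
Proof.
move=> irr_f f_dv; have [K [iota [a [_ fa0 _]]]] := root_field irr_f.
have: eigenvalue (map_mx iota A) a.
  rewrite eigenvalue_root_char -map_char_poly.
  by rewrite (irreducible_root_dvdp _ irr_f fa0).
rewrite eigenvalue_poly => /eigenpolyP[w wa nz_w].
suffices /eigenpolyP[v /sub_kermxP vf0 nz_v] : eigenpoly A f by exists v.
rewrite -(eigenpoly_map iota); apply/eigenpolyP; exists w => //.
apply/sub_kermxP.
move: fa0; rewrite root_factor_theorem => /dvdpP[c ->].
by rewrite mulrC rmorphM mulmxA (sub_kermxP wa) mul0mx.
Qed.

(** Pick an irreducible factor f of h and a vector killed by f(A). It generates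
    an invariant subspace of dimension deg f on which A has characteristic
    polynomial f; conclude by induction, applied to h / f in the quotient. *)
Lemma stable_dvd_char_poly n (A : 'M[F]_n) (h : {poly F}) :
    h %| char_poly A ->
  exists W : 'M_n, (W *m A <= W)%MS /\ \rank W = (size h).-1.
Proof.
have [k] := ubnP (size h); elim: k n A h => // k IHk n A h le_h_k h_dv.
have nz_h : h != 0 by apply: dvdpN0 h_dv _; rewrite monic_neq0 ?char_poly_monic.
have [h_le1 | h_gt1] := leqP (size h) 1.
  exists 0; rewrite mul0mx submx_refl mxrank0; split=> //.
  by case: (size h) h_le1 => [|[]].
have [f0 irr_f0 f0_dv] := irreducible_factor h_gt1.
have [f [irr_f monf eqff0]] := irreducible_monic irr_f0.
have f_dv : f %| h by rewrite (eqp_dvdl _ eqff0).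
case: n A h_dv => [|n] A h_dv.
  have := dvdp_leq (monic_neq0 (char_poly_monic A)) h_dv.
  by rewrite size_char_poly leqNgt h_gt1.
have [v nz_v vf0] := irreducible_ker_neq0 irr_f (dvdp_trans f_dv h_dv).
pose d := (size f).-1.
have freeK : row_free (krylov A v d).
  have freeUK : row_free (col_mx (0 : 'M_(0, n.+1)) (krylov A v d)).
    apply: row_free_krylov; rewrite // ?mul0mx ?sub0mx //.
      by rewrite /row_free mxrank0.
    apply: contraNN nz_v => v0; rewrite -submx0.
    by apply: submx_trans v0 _; apply: sub0mx.
  apply: inj_row_free => u uK.
  have /rowP u0 : row_mx 0 u = 0 :> 'rV_(0 + d).
    by apply: (row_free_inj freeUK); rewrite mul_row_col mulmx0 add0r uK mul0mx.
  by apply/rowP=> i; have := u0 (rshift 0 i); rewrite row_mxEr !mxE.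
have KA := krylov_companion monf vf0; rewrite -/d in KA.
have [s [C [DcA liftC]]] := quotient_stable freeK KA.
have [h' Dh] := dvdpP _ _ f_dv; rewrite mulrC in Dh.
have [f_gt1 _] := irr_f.
have [nz_f nz_h'] : f != 0 /\ h' != 0.
  by apply/andP; rewrite -negb_or -mulf_eq0 -Dh.
have h'_gt0 : (0 < size h')%N by rewrite size_poly_gt0.
have [||W' [stabW' rW']] := IHk _ C h'.
- move: le_h_k; rewrite Dh size_mul //.
  by move: (size f) (size h') f_gt1 h'_gt0; clear; lia.
- have := h_dv; rewrite DcA companionmxK // Dh dvdp_mul2l ?monic_neq0 //.
have [W [stabW rW]] := liftC W' stabW'; exists W; split=> //.
rewrite rW rW' Dh size_mul // /d.
by move: (size f) (size h') f_gt1 h'_gt0; clear; lia.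
Qed.

End Matrices.

(** * Conjugacy of matrix roots of an irreducible polynomial *)

Section Conjugacy.
Local Open Scope ring_scope.

Variables (K : fieldType) (n : nat) (P : {poly K}) (A B : 'M[K]_n.+1).
Hypotheses (irr_P : irreducible_poly P) (monP : P \is monic).
Hypotheses (PA0 : horner_mx A P = 0) (PB0 : horner_mx B P = 0).
Local Notation d := (size P).-1.

(** X and Y are bases of an A-invariant and of a B-invariant subspace, in which
    A and B act by the same matrix C. *)
Let intertwined r (X Y : 'M[K]_(r, n.+1)) (C : 'M_r) :=
  [/\ row_free X, row_free Y, X *m A = C *m X & Y *m B = C *m Y].

Let det_onto r (C : 'M[K]_r) :=
  forall e : K, e != 0 -> exists Z : 'M_r, \det Z = e /\ Z *m C = C *m Z.

Lemma notin_row_space r (X : 'M[K]_(r, n.+1)) :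
  (r < n.+1)%N -> exists v : 'rV_n.+1, ~~ (v <= X)%MS.
Proof.
move=> lt_rn; suffices /row_subPn[i]: ~~ (1%:M <= X)%MS by exists (row i 1%:M).
apply: contraL lt_rn => sub1X; rewrite -leqNgt.
by rewrite -(mxrank1 K n.+1) (leq_trans (mxrankS sub1X)) ?rank_leq_row.
Qed.

(** As P(A) = P(B) = 0, any vector outside the span of X or Y generates a cyclic
    submodule isomorphic to K[X]/(P), and these can be added on both sides. *)
Lemma intertwined_extend r (X Y : 'M[K]_(r, n.+1)) C :
    intertwined X Y C -> (r < n.+1)%N ->
  exists X' Y', @intertwined (r + d) X' Y' (block_mx C 0 0 (companionmx P)).
Proof.
case=> freeX freeY XA YB lt_rn.
have [v notXv] := notin_row_space X lt_rn.
have [w notYw] := notin_row_space Y lt_rn.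
have vP0 : v *m horner_mx A P = 0 by rewrite PA0 mulmx0.
have wP0 : w *m horner_mx B P = 0 by rewrite PB0 mulmx0.
exists (col_mx X (krylov A v d)), (col_mx Y (krylov B w d)).
split.
- by apply: row_free_krylov; rewrite // XA submxMl.
- by apply: row_free_krylov; rewrite // YB submxMl.
- rewrite mul_col_mx XA krylov_companion // mul_block_col.
  by rewrite !mul0mx addr0 add0r.
- rewrite mul_col_mx YB krylov_companion // mul_block_col.
  by rewrite !mul0mx addr0 add0r.
Qed.

Lemma det_onto_block r s (C : 'M[K]_r) (D : 'M_s) :
  det_onto C -> det_onto (block_mx C 0 0 D).
Proof.
move=> ontoC e nz_e; have [Z [dZ ZC]] := ontoC e nz_e.
exists (block_mx Z 0 0 1%:M); rewrite det_lblock det1 mulr1; split=> //.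
by rewrite !mulmx_block !mulmx0 !mul0mx !addr0 !add0r ZC mulmx1 mul1mx.
Qed.

Lemma intertwined_full k r (X Y : 'M[K]_(r, n.+1)) C :
    (n.+1 - r <= k)%N -> intertwined X Y C -> det_onto C ->
  exists X' Y' C', @intertwined n.+1 X' Y' C' /\ det_onto C'.
Proof.
have d_gt0 : (0 < d)%N by have [] := irr_P; case: (size P) => [|[]].
elim: k r X Y C => [|k IHk] r X Y C le_k XYC ontoC.
  have Dr : r = n.+1.
    apply/eqP; rewrite eqn_leq -[X in _ && X]subn_eq0 -leqn0 le_k andbT.
    by case: XYC => /eqP rX _ _ _; rewrite -{1}rX rank_leq_col.
  by subst r; exists X, Y, C.
have [ge_r | lt_r] := leqP n.+1 r.
  by apply: (IHk r X Y C) => //; rewrite (eqP (_ : n.+1 - r == 0)%N) ?subn_eq0.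
have [X' [Y' XYC']] := intertwined_extend XYC lt_r.
apply: (IHk _ X' Y' _ _ XYC'); last exact: det_onto_block.
by move: (size P).-1 d_gt0 le_k lt_r; clear; lia.
Qed.

Hypothesis norm_onto :
  forall e : K, e != 0 -> exists j, e = \det (companionmx P) ^+ j.

Lemma det_companion_exp (R : comNzRingType) m (C : 'M[R]_m) j :
  exists Z : 'M_m, \det Z = \det C ^+ j /\ Z *m C = C *m Z.
Proof.
elim: j => [|j [Z [dZ ZC]]].
  by exists 1%:M; rewrite det1 expr0 mul1mx mulmx1.
by exists (C *m Z); rewrite det_mulmx dZ exprS -mulmxA ZC.
Qed.

(** Building bases for A and for B in parallel gives X A X^-1 = C = Y B Y^-1, so
    that Y^-1 X conjugates A to B, and so does Y^-1 Z X for every Z commuting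
    with C. Since det Z is arbitrary, so is the determinant of the conjugating
    matrix. *)
Lemma mx_roots_conj_det (e : K) : e != 0 ->
  exists S : 'M[K]_n.+1, \det S = e /\ S *m A = B *m S.
Proof.
move=> nz_e.
(* The first cyclic summand is what makes the determinant onto: there Z may be
   any power of the companion matrix. *)
have XY0 : @intertwined 0 0 0 0.
  by split; rewrite ?mul0mx ?mulmx0 // /row_free mxrank0.
have [X1 [Y1 XY1]] := intertwined_extend XY0 (ltn0Sn n).
have onto1 : det_onto (block_mx (0 : 'M[K]_0) 0 0 (companionmx P)).
  move=> c nz_c; have [j ->] := norm_onto nz_c.
  have [Z [dZ ZC]] := det_companion_exp (companionmx P) j.
  exists (block_mx 0 0 0 Z); rewrite det_lblock det_mx00 mul1r dZ; split=> //.
  by rewrite !mulmx_block !mulmx0 !mul0mx !addr0 !add0r ZC.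
have [X [Y [C [[freeX freeY XA YB] ontoC]]]] :=
  intertwined_full (leqnn _) XY1 onto1.
have uX : X \in unitmx by rewrite -row_free_unit.
have uY : Y \in unitmx by rewrite -row_free_unit.
have nzX : \det X != 0 by rewrite -unitfE -unitmxE.
have nzY : \det Y != 0 by rewrite -unitfE -unitmxE.
have [|Z [dZ ZC]] := ontoC (\det Y * e * (\det X)^-1).
  by rewrite !mulf_neq0 ?invr_eq0.
exists (invmx Y *m Z *m X); split.
  by rewrite !det_mulmx dZ det_inv -mulrA mulfVK // mulKf.
have YC : invmx Y *m C = B *m invmx Y.
  by rewrite -[C](mulmxK uY) -YB !mulmxA mulVmx // mul1mx.
by rewrite -!mulmxA XA [Z *m _]mulmxA ZC !mulmxA YC.
Qed.

End Conjugacy.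

(** * Normal coverings of a finite group *)

Section NormalCoverings.
Local Open Scope group_scope.

Variables (gT : finGroupType) (G : {group gT}).

Definition class_covered (Q : gT -> Prop) := exists H : {group gT},
  H \proper G /\ forall x, x \in G -> Q x -> exists2 g, g \in G & x \in H :^ g.

Lemma gamma_le (ncG : ~~ cyclic G) (T : eqType) (t : seq T)
    (Q : T -> gT -> Prop) :
    (forall i, i \in t -> class_covered (Q i)) ->
    (forall x, x \in G -> exists2 i, i \in t & Q i x) ->
  (gamma ncG <= size t)%N.
Proof.
move=> covQ covG.
have /fin_all_exists[H covH] (i : 'I_(size t)) : exists H : {group gT},
    H \proper G /\ forall x, x \in G -> Q (tnth (in_tuple t) i) x ->
      exists2 g, g \in G & x \in H :^ g.
  by apply: covQ; apply: mem_tnth.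
rewrite /gamma; case: ex_minnP => m _; apply.
apply/existsP; exists [ffun i => H i]; apply/andP; split.
  by apply/forallP=> i; rewrite ffunE; case: (covH i).
rewrite eqEsubset; apply/andP; split.
  apply/subsetP=> x Gx; have [j /(tnthP (in_tuple t))[i ->] Qx] := covG x Gx.
  have [_ /(_ x Gx Qx)[g Gg Hx]] := covH i.
  by apply/bigcupP; exists i => //; apply/bigcupP; exists g; rewrite ?ffunE.
apply/bigcupsP=> i _; apply/bigcupsP=> g Gg; have [/proper_sub sHG _] := covH i.
by rewrite ffunE -(conjGid Gg) conjSg.
Qed.

Lemma mem_conjI (H : {group gT}) g x :
  g \in G -> x \in G -> g * x * g^-1 \in H -> x \in (G :&: H) :^ g.
Proof.
move=> Gg Gx Hx; rewrite mem_conjg conjgE invgK mulgA inE Hx andbT.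
by rewrite !groupM ?groupV.
Qed.

End NormalCoverings.

(** * Components of a normal covering of a linear group *)

Section LinearGroups.
Local Open Scope ring_scope.

Variables (F : finFieldType) (m : nat).
Local Notation n := m.+2.
Local Notation GL := {'GL_n[F]}.
Implicit Types (A : 'M[F]_n) (x : GL).

(** The span of the first k coordinate vectors, given by [pid_mx k], represents
    all k-dimensional subspaces up to the action of SL_n(q). *)
Definition subspace_stabiliser k : {set GL} :=
  [set x : GL | ((pid_mx k : 'M[F]_n) *m GLval x <= (pid_mx k : 'M[F]_n))%MS].

Lemma subspace_stabiliser_group_set k : group_set (subspace_stabiliser k).
Proof.
apply/group_setP; split=> [|x y]; rewrite !inE; first by rewrite GL_1E mulmx1.
by move=> sx sy; rewrite GL_MxE stablemxM.
Qed.
Canonical subspace_stabiliser_group k :=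
  Group (subspace_stabiliser_group_set k).

Definition mx_centraliser A : {set GL} :=
  [set x : GL | A *m GLval x == GLval x *m A].

Lemma mx_centraliser_group_set A : group_set (mx_centraliser A).
Proof.
apply/group_setP; split=> [|x y]; rewrite !inE.
  by rewrite GL_1E mulmx1 mul1mx.
move=> /eqP cx /eqP cy; apply/eqP.
by rewrite GL_MxE mulmxA cx -[LHS]mulmxA cy mulmxA.
Qed.
Canonical mx_centraliser_group A := Group (mx_centraliser_group_set A).

Lemma SL_of_mx (S : 'M[F]_n) :
  \det S = 1 -> exists2 g : GL, g \in SL n F & GLval g = S.
Proof.
move=> dS; have uS : S \in unitmx by rewrite unitmxE dS unitr1.
by exists (Sub S uS : GL); rewrite ?inE SubK // dS.
Qed.

Lemma det_transvection (i j : 'I_n) :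
  i != j -> \det (1%:M + delta_mx i j : 'M[F]_n) = 1.
Proof.
wlog lt_ij : i j / (j < i)%N => [wl ne_ij|_].
  have [lt_ji|lt_ij|/val_inj e_ij] := ltngtP j i; first exact: wl.
    by rewrite -det_tr linearD /= trmx1 trmx_delta wl // eq_sym.
  by rewrite e_ij eqxx in ne_ij.
rewrite det_trig => [|]; last first.
  apply/is_trig_mxP=> a b lt_ab; rewrite !mxE -val_eqE (ltn_eqF lt_ab) add0r.
  by case: eqP lt_ab => //= ->; case: eqP => //= ->; rewrite ltnNge ltnW.
apply: big1 => a _; rewrite !mxE eqxx.
by case: (a =P i) => //= [->|]; rewrite -?val_eqE ?(gtn_eqF lt_ij) addr0.
Qed.

(** Numbering coordinates from 0, the transvection sending e_0 to e_0 + e_k does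
    not preserve the span of e_0, ..., e_(k-1). *)
Lemma SL_not_stabiliser k :
  (0 < k < n)%N -> ~~ (SL n F \subset subspace_stabiliser k).
Proof.
case/andP=> k_gt0 lt_kn; pose j : 'I_n := Ordinal lt_kn.
have ne0j : ord0 != j :> 'I_n by rewrite -val_eqE /= eq_sym -lt0n.
have [g SLg Dg] := SL_of_mx (det_transvection ne0j).
apply/subsetPn; exists g; rewrite // inE Dg mulmxDr mulmx1.
apply/negP=> /submxP[X /matrixP/(_ ord0 j)].
rewrite mxE [X in _ + X]mxE (bigD1 ord0) //= big1 => [|l ne_l]; last first.
  by rewrite [delta_mx _ _ _ _]mxE (negPf ne_l) mulr0.
rewrite [RHS]mxE big1 => [|l _]; last first.
  by rewrite mxE; case: eqP => [->|]; rewrite /= ?ltnn mulr0.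
rewrite !mxE eqxx k_gt0 /= (ltn_eqF k_gt0) eqxx /= mulr1 addr0 add0r.
by move/eqP; rewrite oner_eq0.
Qed.

(** A matrix commuting with all transvections is scalar, and the scalar would be
    a root in F of P, which is irreducible of degree at least 2. *)
Lemma SL_not_centraliser A (P : {poly F}) :
    irreducible_poly P -> (2 < size P)%N -> horner_mx A P = 0 ->
  ~~ (SL n F \subset mx_centraliser A).
Proof.
move=> irr_P P_gt2 PA0; apply: contraL P_gt2 => /subsetP sSLC.
have comm_delta (i j : 'I_n) : i != j -> A *m delta_mx i j = delta_mx i j *m A.
  move=> ne_ij; have [g SLg Dg] := SL_of_mx (det_transvection ne_ij).
  have := sSLC g SLg; rewrite inE Dg mulmxDl mulmxDr mul1mx mulmx1.
  by move/eqP/addrI.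
have A_entry (a i j : 'I_n) : i != j -> A a i = if a == i then A j j else 0.
  move=> ne_ij; have /matrixP/(_ a j) := comm_delta i j ne_ij.
  rewrite !mxE (bigD1 i) //= big1 => [|l ne_l]; last first.
    by rewrite !mxE (negPf ne_l) mulr0.
  rewrite !mxE !eqxx mulr1 addr0 => ->.
  rewrite (bigD1 j) //= big1 => [|l ne_l]; last first.
    by rewrite !mxE (negPf ne_l) andbF mul0r.
  by rewrite !mxE eqxx andbT addr0; case: (a == i); rewrite ?mul1r ?mul0r.
have ne01 : ord0 != ord_max :> 'I_n by [].
have DA : A = (A ord0 ord0)%:M.
  apply/matrixP=> a i; rewrite !mxE; have [-> | ne_i0] := eqVneq i ord0.
    by rewrite (A_entry a _ _ ne01) (A_entry ord0 _ _ ne01) eqxx; case: eqP.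
  by rewrite (A_entry _ _ _ ne_i0); case: eqP.
move: PA0; set a := A ord0 ord0 in DA *.
have -> : A = horner_mx A a%:P by rewrite horner_mx_C.
rewrite -horner_mx_comp comp_polyCr horner_mx_C => /matrixP/(_ ord0 ord0).
rewrite !mxE eqxx => /eqP Pa0.
have := irr_P.2 ('X - a%:P); rewrite size_XsubC dvdp_XsubCl => /(_ isT Pa0).
by move/eqp_size => <-; rewrite size_XsubC.
Qed.

Lemma GL_subgroup_proper (G H : {group GL}) :
  SL n F \subset G -> ~~ (SL n F \subset H) -> (G :&: H)%G \proper G.
Proof.
move=> sSLG nsSLH; rewrite properE subsetIl /=.
by apply: contra nsSLH; rewrite subsetI => /andP[_]; apply: subset_trans.
Qed.

(** SL_n(q) is transitive on the subspaces of dimension k: a basis adapted to W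
    can be rescaled to have determinant 1 without changing the span W of its
    first k vectors. *)
Lemma class_covered_stabiliser (G : {group GL}) k :
    SL n F \subset G -> (0 < k < n)%N ->
  class_covered G (fun x => exists2 h, h %| char_poly (GLval x) &
    ((size h).-1 == k) || ((size h).-1 == n - k)%N).
Proof.
move=> sSLG k_bd; exists (G :&: subspace_stabiliser_group k)%G.
split; first by apply: GL_subgroup_proper; rewrite // SL_not_stabiliser.
move=> x Gx [h0 h0_dv sh0].
have [h h_dv sh] : exists2 h, h %| char_poly (GLval x) & (size h).-1 = k.
  case/orP: sh0 => /eqP sh0; first by exists h0.
  have [h Dchi] := dvdpP _ _ h0_dv; exists h; first by rewrite Dchi dvdp_mulr.
  have := size_char_poly (GLval x); rewrite Dchi.
  have : h * h0 != 0 by rewrite -Dchi monic_neq0 ?char_poly_monic.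
  rewrite mulf_eq0 negb_or -!size_poly_gt0 => /andP[h_gt0 h0_gt0].
  rewrite size_mul -?size_poly_gt0 //.
  by move: (size h) (size h0) sh0 h_gt0 h0_gt0 k_bd; clear; lia.
have [W [stabW rW]] := stable_dvd_char_poly h_dv; rewrite sh in rW.
pose E := row_ebase W; pose e := (\det E)^-1.
have uE : E \in unitmx := row_ebase_unit W.
(* The rescaling D corrects the determinant of E, and it preserves every
   coordinate subspace. *)
pose D := diag_mx (\row_(i < n) (if i == ord0 then e else 1)).
have dD : \det D = e.
  rewrite det_diag (bigD1 ord0) //= big1 => [|i ne_i0]; last first.
    by rewrite mxE (negPf ne_i0).
  by rewrite mxE eqxx mulr1.
have uD : D \in unitmx by rewrite unitmxE dD unitrV -unitmxE.
pose pk := pid_mx k : 'M[F]_n.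
have pkD : pk *m D = D *m pk.
  apply/matrixP=> i j; rewrite mul_mx_diag mul_diag_mx !mxE -val_eqE /=.
  by case: (i =P j :> nat) => [/val_inj->|_]; rewrite ?mul0r ?mulr0 // mulrC.
have [g SLg Dg] : exists2 g : GL, g \in SL n F & GLval g = D *m E.
  by apply: SL_of_mx; rewrite det_mulmx dD mulVf // -unitfE -unitmxE.
have eqW : (pk *m GLval g :=: W)%MS.
  rewrite Dg mulmxA pkD -mulmxA.
  apply: eqmx_trans (eqmxMfull _ _) _; first by rewrite row_full_unit.
  rewrite -[X in (_ :=: X)%MS](mulmx_ebase W) rW -mulmxA; apply: eqmx_sym.
  by apply: eqmxMfull; rewrite row_full_unit col_ebase_unit.
have Gg : g \in G := subsetP sSLG g SLg.
exists g => //; apply: mem_conjI => //.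
rewrite inE !GL_MxE GL_VxE !mulmxA -/pk.
rewrite -[X in (_ <= X)%MS](mulmxK (GL_unitmx g) pk) submxMr //.
by rewrite (eqmxMr _ eqW) eqW.
Qed.

(** An element x as in the statement centralises some matrix B = h(x) with
    P(B) = 0. Such matrices form one class under SL_n(q), so x is conjugate to
    an element centralising a fixed one, A. *)
Lemma class_covered_centraliser (G : {group GL}) p :
    SL n F \subset G -> (1 < p)%N ->
  class_covered G (fun x => forall f, irreducible_poly f ->
    f %| char_poly (GLval x) -> (p %| (size f).-1)%N).
Proof.
move=> sSLG p_gt1.
have [P [irr_P monP sP norm_onto]] := irreducible_norm_generator F (ltnW p_gt1).
have root_of_degrees x : (forall f, irreducible_poly f ->
      f %| char_poly (GLval x) -> (p %| (size f).-1)%N) ->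
    exists h, horner_mx (horner_mx (GLval x) h) P = 0.
  move=> dvd_p; have nz_chi := monic_neq0 (char_poly_monic (GLval x)).
  have [|h h_dv] := comp_poly_root_mod irr_P nz_chi; first by rewrite sP.
  exists h; rewrite -horner_mx_comp; have [c ->] := dvdpP _ _ h_dv.
  by rewrite rmorphM /= Cayley_Hamilton mulr0.
have [/existsP[A /eqP PA0] | noA] :=
  boolP [exists A : 'M[F]_n, horner_mx A P == 0]; last first.
  (* If P has no root among the matrices of size n, then no x satisfies the
     hypothesis, and any proper subgroup will do. *)
  exists (G :&: subspace_stabiliser_group 1)%G; split.
    by apply: GL_subgroup_proper; rewrite // SL_not_stabiliser.
  move=> x _ /root_of_degrees[h /eqP xhP0]; case/existsP: noA.
  by exists (horner_mx (GLval x) h).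
exists (G :&: mx_centraliser_group A)%G; split.
  by apply: GL_subgroup_proper; rewrite // (SL_not_centraliser irr_P) ?sP.
move=> x Gx /root_of_degrees[h PB0]; set B := horner_mx _ h in PB0.
have [S [dS SB]] :=
  mx_roots_conj_det irr_P monP PB0 PA0 norm_onto (oner_neq0 F).
have [g SLg Dg] := SL_of_mx dS; have Gg : g \in G := subsetP sSLG g SLg.
exists g => //; apply: mem_conjI => //.
have xB : GLval x *m B = B *m GLval x.
  by apply: comm_mx_horner.
have uS : S \in unitmx by rewrite -Dg GL_unitmx.
rewrite inE !GL_MxE GL_VxE Dg !mulmxA -SB -[S *m B *m _]mulmxA -xB; apply/eqP.
rewrite -!mulmxA; congr (_ *m (_ *m _)).
by rewrite -{1}[B](mulKmx uS) SB -!mulmxA mulmxV ?mulmx1.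
Qed.

End LinearGroups.

(** The subgroups are the centralisers attached to the degrees in ps and the
    subspace stabilisers attached to the dimensions in ks; whether an element
    is covered depends only on its characteristic polynomial g. *)
Lemma gamma_le_degrees (F : finFieldType) m (G : {group {'GL_m.+2[F]}})
    (ncG : ~~ cyclic G) (ps ks : seq nat) :
    SL m.+2 F \subset G ->
    (forall p, p \in ps -> (1 < p)%N) ->
    (forall k, k \in ks -> (0 < k < m.+2)%N) ->
    (forall g : {poly F}, size g = m.+3 ->
       (exists2 p, p \in ps & forall f, irreducible_poly f -> (f %| g)%R ->
          (p %| (size f).-1)%N)
       \/ (exists2 k, k \in ks & exists2 h, (h %| g)%R &
          ((size h).-1 == k) || ((size h).-1 == m.+2 - k)%N)) ->
  (gamma ncG <= size ps + size ks)%N.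
Proof.
move=> sSLG ps_gt1 ks_bd covg.
pose Q (i : nat + nat) (x : {'GL_m.+2[F]}) := let g := char_poly (GLval x) in
  match i with
  | inl p => forall f, irreducible_poly f -> (f %| g)%R -> (p %| (size f).-1)%N
  | inr k => exists2 h, (h %| g)%R
      & ((size h).-1 == k) || ((size h).-1 == m.+2 - k)%N
  end.
rewrite -(size_map (@inl nat nat) ps) -(size_map (@inr nat nat) ks) -size_cat.
apply: (@gamma_le _ _ _ _ _ Q) => [i | x _].
  rewrite mem_cat => /orP[] /mapP[j s_j ->].
    by apply: class_covered_centraliser; rewrite ?ps_gt1.
  by apply: class_covered_stabiliser; rewrite ?ks_bd.
have [|[p ps_p Qp] | [k ks_k Qk]] := covg (char_poly (GLval x)).
- by rewrite size_char_poly.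
- by exists (inl p); rewrite ?mem_cat ?map_f.
by exists (inr k); rewrite ?mem_cat ?map_f ?orbT.
Qed.

(** * Degrees of divisors of a polynomial *)

Section Degrees.
Local Open Scope ring_scope.

Variable F : finFieldType.
Implicit Types f g h : {poly F}.

Lemma irreducible_dvd_eqp f g :
  irreducible_poly f -> irreducible_poly g -> f %| g -> f %= g.
Proof. by move=> [f_gt1 _] [_ div_g]; apply: div_g; rewrite gtn_eqF. Qed.

(** An irreducible polynomial dividing c f, with f irreducible, divides c or is
    associate to f: peeling off factors one at a time tests Q on all degrees. *)
Lemma irreducible_factors_dec (Q : pred nat) g : g != 0 ->
  (forall f, irreducible_poly f -> f %| g -> Q (size f).-1)
  \/ (exists f, [/\ irreducible_poly f, f %| g & ~~ Q (size f).-1]).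
Proof.
have [k] := ubnP (size g); elim: k g => // k IHk g le_g_k nz_g.
have [g_le1 | g_gt1] := leqP (size g) 1.
  left=> f [f_gt1 _] /(dvdp_leq nz_g) le_fg.
  by have := leq_trans f_gt1 (leq_trans le_fg g_le1).
have [f irr_f /dvdpP[c Dg]] := irreducible_factor g_gt1.
have [f_gt1 _] := irr_f.
have [nz_c nz_f] : c != 0 /\ f != 0.
  by apply/andP; rewrite -negb_or -mulf_eq0 -Dg.
have [Qf | notQf] := boolP (Q (size f).-1); last first.
  by right; exists f; rewrite Dg dvdp_mull.
have [|Qc | [e [irr_e e_dv notQe]]] := IHk c _ nz_c.
- move: le_g_k; rewrite Dg size_mul //.
  by move: (size f) (size c) f_gt1; clear; lia.
- left=> e irr_e; rewrite Dg irreducible_dvdpM // => /orP[|e_dv_f].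
    exact: Qc.
  by rewrite (eqp_size (irreducible_dvd_eqp irr_e irr_f e_dv_f)).
by right; exists e; rewrite Dg dvdp_mulr.
Qed.

(** Suppose that f and e are irreducible factors of g of degrees prime to p and
    to r respectively. If neither degree is prime to p r, then r divides deg f
    and p divides deg e, so deg f + deg e is prime to p r; and f and e are
    coprime since their degrees differ modulo p. *)
Lemma coprime_divisor p r g :
    prime p -> prime r -> g != 0 ->
  (exists2 p', p' \in [:: p; r] & forall f, irreducible_poly f -> f %| g ->
          (p' %| (size f).-1)%N)
  \/ (exists2 h, h %| g & coprime (p * r) (size h).-1).
Proof.
move=> p_pr r_pr nz_g.
have [allp | [f [irr_f f_dv ndv_pf]]] := irreducible_factors_dec (dvdn p) nz_g.
  by left; exists p; rewrite ?inE ?eqxx.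
have [allr | [e [irr_e e_dv ndv_re]]] := irreducible_factors_dec (dvdn r) nz_g.
  by left; exists r; rewrite ?inE ?eqxx ?orbT.
have co_deg d : coprime (p * r) d = ~~ (p %| d)%N && ~~ (r %| d)%N.
  by rewrite coprimeMl !prime_coprime.
right; have [dv_rf | ndv_rf] := boolP (r %| (size f).-1)%N; last first.
  by exists f; rewrite // co_deg ndv_pf.
have [dv_pe | ndv_pe] := boolP (p %| (size e).-1)%N; last first.
  by exists e; rewrite // co_deg ndv_pe.
have co_fe : coprimep f e.
  rewrite irreducible_poly_coprime //; apply: contra ndv_pf => f_dv_e.
  by rewrite (eqp_size (irreducible_dvd_eqp irr_f irr_e f_dv_e)).
exists (f * e); first by rewrite Gauss_dvdp // f_dv.
have -> : (size (f * e)).-1 = ((size f).-1 + (size e).-1)%N.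
  rewrite size_mul ?irredp_neq0 //.
  have [[f_gt1 _] [e_gt1 _]] := (irr_f, irr_e).
  by move: (size f) (size e) f_gt1 e_gt1; clear; lia.
by rewrite co_deg dvdn_addl // ndv_pf dvdn_addr.
Qed.

(** Three nonconstant factors cannot all have degree above n / 3, so unless the
    second case holds g is irreducible, and any prime factor of n works, or g is
    the product of two irreducibles of degrees d and n - d above n / 3. Then d
    is coprime to n, or a prime factor of both d and n divides both degrees. *)
Lemma small_or_coprime_divisor n g : (2 < n)%N -> size g = n.+1 ->
  [\/ exists2 p, p \in primes n & forall f, irreducible_poly f -> f %| g ->
          (p %| (size f).-1)%N,
      exists2 h, h %| g & (0 < (size h).-1 <= n %/ 3)%N
    | exists2 h, h %| g & [&& coprime (size h).-1 n, n < 3 * (size h).-1 &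
        n < 3 * (n - (size h).-1)]%N].
Proof.
move=> n_gt2 sg; have nz_g : g != 0 by rewrite -size_poly_gt0 sg.
have [|f irr_f /dvdpP[c Dg]] := @irreducible_factor _ g.
  by rewrite sg ltnS ltnW // ltnW.
have [f_gt1 _] := irr_f.
have [nz_c nz_f] : c != 0 /\ f != 0.
  by apply/andP; rewrite -negb_or -mulf_eq0 -Dg.
have sum_cf : ((size c).-1 + (size f).-1 = n)%N.
  have := sg; rewrite Dg size_mul //.
  move: nz_c; rewrite -size_poly_gt0.
  by move: (size f) (size c) f_gt1; clear; lia.
have f_dv : f %| g by rewrite Dg dvdp_mull.
have [c_le1 | c_gt1] := leqP (size c) 1.
  constructor 1; exists (pdiv n).
    by rewrite mem_primes pdiv_prime ?pdiv_dvd ?(ltn_trans _ n_gt2).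
  move=> e irr_e; rewrite Dg irreducible_dvdpM // => /orP[e_dv_c | e_dv_f].
    have := leq_trans (dvdp_leq nz_c e_dv_c) c_le1.
    by have [e_gt1 _] := irr_e; rewrite leqNgt e_gt1.
  rewrite (eqp_size (irreducible_dvd_eqp irr_e irr_f e_dv_f)).
  have -> : ((size f).-1 = n)%N by move: sum_cf; case: (size c) c_le1 => [|[]].
  exact: pdiv_dvd.
have [e irr_e /dvdpP[b Dc]] := irreducible_factor c_gt1.
have [e_gt1 _] := irr_e.
have [nz_b nz_e] : b != 0 /\ e != 0.
  by apply/andP; rewrite -negb_or -mulf_eq0 -Dc.
have sum_bef : ((size b).-1 + (size e).-1 + (size f).-1 = n)%N.
  rewrite -sum_cf Dc size_mul //.
  move: nz_b; rewrite -size_poly_gt0.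
  by move: (size e) (size b) (size f) e_gt1; clear; lia.
have e_dv : e %| g by rewrite Dg Dc dvdp_mulr // dvdp_mull.
have b_dv : b %| g by rewrite Dg Dc -mulrA dvdp_mulr.
have [f_le | f_gt] := leqP (size f).-1 (n %/ 3).
  by constructor 2; exists f; rewrite // f_le andbT -ltnS prednK // ltnW.
have [e_le | e_gt] := leqP (size e).-1 (n %/ 3).
  by constructor 2; exists e; rewrite // e_le andbT -ltnS prednK // ltnW.
have [b_le1 | b_gt1] := leqP (size b) 1; last first.
  constructor 2; exists b => //.
  by move: (size b) (size e) (size f) sum_bef f_gt e_gt b_gt1; clear; lia.
have sum_ef : ((size e).-1 + (size f).-1 = n)%N.
  by move: sum_bef; case: (size b) b_le1 => [|[]].
have [co_fn | nco_fn] := boolP (coprime (size f).-1 n).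
  constructor 3; exists f; rewrite // co_fn /=.
  by move: (size e).-1 (size f).-1 sum_ef f_gt e_gt; clear; lia.
constructor 1; pose p := pdiv (gcdn (size f).-1 n).
have p_pr : prime p.
  rewrite pdiv_prime // ltn_neqAle eq_sym nco_fn /= gcdn_gt0.
  by rewrite (ltn_trans _ n_gt2) ?orbT.
have [p_dv_f p_dv_n] : (p %| (size f).-1)%N /\ (p %| n)%N.
  by apply/andP; rewrite -dvdn_gcd pdiv_dvd.
have p_dv_e : (p %| (size e).-1)%N.
  by move: p_dv_n; rewrite -sum_ef dvdn_addl.
exists p; first by rewrite mem_primes p_pr p_dv_n (ltn_trans _ n_gt2).
move=> u irr_u; rewrite Dg Dc !irreducible_dvdpM // -orbA.
case/or3P=> [u_dv|u_dv|u_dv].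
- have := leq_trans (dvdp_leq nz_b u_dv) b_le1.
  by have [u_gt1 _] := irr_u; rewrite leqNgt u_gt1.
- by rewrite (eqp_size (irreducible_dvd_eqp irr_u irr_e u_dv)).
by rewrite (eqp_size (irreducible_dvd_eqp irr_u irr_f u_dv)).
Qed.

End Degrees.

(** * Counting dimensions, and the two bounds *)

Lemma sum_coprime_mul N a :
  \sum_(0 <= k < a * N) coprime N k = (a * totient N)%N.
Proof.
elim: a => [|a IHa]; first by rewrite !mul0n big_nil.
rewrite mulSn addnC (@big_cat_nat _ _ _ (a * N)) ?leq_addr //= IHa.
rewrite -{1}[(a * N)%N]add0n big_addn addnC addKn mulSn; congr (_ + _)%N.
rewrite totient_count_coprime; apply: eq_bigr => k _.
by rewrite -coprime_modr addnC modnMDl coprime_modr.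
Qed.

Lemma coprime_subr N n k :
  (N %| n)%N -> (k <= n)%N -> coprime N (n - k) = coprime N k.
Proof.
move=> N_dv le_kn; suffices dv j : (j <= n)%N -> (gcdn N (n - j) %| gcdn N j)%N.
  rewrite /coprime; congr (_ == _); apply/eqP; rewrite eqn_dvd dv //=.
  by rewrite -{1}(subKn le_kn) dv ?leq_subr.
move=> le_jn; rewrite dvdn_gcd dvdn_gcdl -{2}(subKn le_jn).
by rewrite dvdn_sub ?dvdn_gcdr // (dvdn_trans (dvdn_gcdl _ _)).
Qed.

(** One dimension from each pair k, n - k of dimensions coprime to N. *)
Definition half_coprimes N n :=
  [seq k <- index_iota 1 n | (k.*2 < n)%N && coprime N k].

(** The involution k |-> n - k preserves coprimality to N when N divides n, so
    at most half of the a * totient N integers below n = a N that are coprime to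
    N lie below n / 2. *)
Lemma size_half_coprimes N a : (1 < N)%N ->
  ((size (half_coprimes N (a * N))).*2 <= a * totient N)%N.
Proof.
move=> N_gt1; set n := (a * N)%N.
have -> : size (half_coprimes N n)
    = \sum_(1 <= k < n) ((k.*2 < n)%N && coprime N k).
  rewrite size_filter -sum1_count big_mkcond.
  by apply: eq_bigr => k _; case: (_ && _).
rewrite -addnn {2}big_nat_rev -big_split -sum_coprime_mul -/n /=.
have [->|n_gt0] := posnP n; first by rewrite !big_geq.
rewrite [leqRHS]big_ltn // /coprime gcdn0 -/(coprime _ _) (gtn_eqF N_gt1) add0n.
rewrite big_nat_cond [leqRHS]big_nat_cond.
apply: leq_sum => k /andP[/andP[k_gt0 lt_kn] _].
have -> : (1 + n - k.+1 = n - k)%N by rewrite add1n subSS.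
rewrite -!/(coprime _ _).
have -> : coprime N (n - k) = coprime N k.
  by rewrite coprime_subr ?dvdn_mull // ltnW.
by case: (coprime N k); rewrite ?andbF ?andbT //; lia.
Qed.

(** The condition N > 2 excludes the midpoint k = n / 2: it would make N divide
    2 k, hence 2. *)
Lemma mem_half_coprimes N n k :
    (2 < N)%N -> (N %| n)%N -> coprime N k -> (k <= n)%N ->
  exists2 j, j \in half_coprimes N n & (k == j) || (k == n - j)%N.
Proof.
move=> N_gt2 N_dv co_k le_kn.
have ndv_k : ~~ (N %| k)%N.
  apply: contraL co_k => /gcdn_idPl; rewrite /coprime => ->.
  by rewrite gtn_eqF // ltnW.
have k_gt0 : (0 < k)%N by case: (k) ndv_k; rewrite ?dvdn0.
have lt_kn : (k < n)%N.
  by rewrite ltn_neqAle le_kn andbT; apply: contraNneq ndv_k => ->.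
have ne_k2n : k.*2 != n.
  apply: contraTneq N_dv => <-; rewrite -mul2n mulnC Gauss_dvdr //.
  by rewrite gtnNdvd.
have [lt_k2n | ge_k2n] := ltnP k.*2 n.
  exists k; rewrite ?eqxx // mem_filter lt_k2n co_k mem_index_iota.
  by rewrite k_gt0.
exists (n - k)%N; last by rewrite subKn ?eqxx ?orbT.
rewrite mem_filter mem_index_iota coprime_subr // co_k andbT.
by move: ne_k2n ge_k2n lt_kn k_gt0; clear; lia.
Qed.

Theorem theorem1p1 (n : nat) (n_gt1 : (1 < n)%N) (F : finFieldType)
    (G : {group {'GL_n[F]}}) (sSLG : SL n F \subset G) :
  let nu := size (primes n) in
  let p1 := nth 0%N (primes n) 0 in
  let p2 := nth 0%N (primes n) 1 in
  let gammaG := gamma (SL_overgroup_noncyclic n_gt1 sSLG) in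
  ((2 <= nu)%N ->
     (gammaG%:R <= (1 - 1 / p1%:R) * (1 - 1 / p2%:R) * (n%:R / 2) + 2 :> rat)%R)
  /\
  ((6 < n)%N -> (gammaG <= n %/ 3 + lehmer_totient 6 2 n + nu)%N).
Proof.
case: n n_gt1 G sSLG => [|[|m]] // n_gt1 G sSLG.
set n := m.+2 in n_gt1 G sSLG *.
move=> nu p1 p2 gammaG; split=> [nu_ge2 | n_gt6].
  have p1_in : p1 \in primes n by rewrite mem_nth // ltnW.
  have p2_in : p2 \in primes n by rewrite mem_nth.
  have [p1_pr p1_dv] : prime p1 /\ (p1 %| n)%N.
    by move: p1_in; rewrite mem_primes => /and3P[].
  have [p2_pr p2_dv] : prime p2 /\ (p2 %| n)%N.
    by move: p2_in; rewrite mem_primes => /and3P[].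
  have ne_p : p1 != p2 by rewrite nth_uniq ?primes_uniq // ltnW.
  have co_p : coprime p1 p2 by rewrite prime_coprime // dvdn_prime2.
  have N_dv : (p1 * p2 %| n)%N by rewrite Gauss_dvd // p1_dv.
  have N_gt2 : (2 < p1 * p2)%N.
    have := leq_mul (prime_gt1 p1_pr) (prime_gt1 p2_pr).
    exact: (@leq_trans (2 * 2) 3).
  have N_gt1 := ltnW N_gt2.
  (* Components: the fields of degrees p1 and p2, and one subspace stabiliser
     for each dimension below n / 2 coprime to p1 p2. *)
  have le_gamma : (gammaG <= 2 + size (half_coprimes (p1 * p2) n))%N.
    apply: (@gamma_le_degrees _ _ _ _ [:: p1; p2]) => //.
    - by move=> p; rewrite !inE => /orP[] /eqP->; apply: prime_gt1.
    - by move=> k; rewrite mem_filter mem_index_iota => /andP[].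
    move=> g sg; have nz_g : g != 0%R by rewrite -size_poly_gt0 sg.
    have [?|[h h_dv co_h]] := coprime_divisor p1_pr p2_pr nz_g; first by left.
    right.
    have le_hn : ((size h).-1 <= n)%N.
      by have := dvdp_leq nz_g h_dv; rewrite sg; case: (size h).
    have [j half_j Dj] := mem_half_coprimes N_gt2 N_dv co_h le_hn.
    by exists j => //; exists h.
  have [a Dn] := dvdnP N_dv.
  have := size_half_coprimes a N_gt1.
  rewrite -Dn totient_coprime // !totient_prime //.
  move: (size _) le_gamma => s le_gamma le_s.
  have p1_gt0 := prime_gt0 p1_pr; have p2_gt0 := prime_gt0 p2_pr.
  have le_s' : (s%:R * 2 <= a%:R * ((p1%:R - 1) * (p2%:R - 1)) :> rat)%R.
    have Dpred p : (0 < p)%N -> (p.-1%:R = p%:R - 1 :> rat)%R.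
      by move=> p_gt0; rewrite -subn1 natrB.
    by rewrite -!Dpred // -!natrM ler_nat muln2.
  have le_g' : (gammaG%:R <= 2 + s%:R :> rat)%R by rewrite -natrD ler_nat.
  rewrite Dn !natrM.
  have -> : ((1 - 1 / p1%:R) * (1 - 1 / p2%:R)
        * (a%:R * (p1%:R * p2%:R) / 2) + 2
      = a%:R * ((p1%:R - 1) * (p2%:R - 1)) / 2 + 2 :> rat)%R.
    by field; rewrite !pnatr_eq0 -!lt0n p1_gt0 p2_gt0.
  by lra.
(* L is the set counted by the partial totient: 2 / 6 and 3 / 6 are 1 / 3 and
   1 / 2. *)
pose L := [set x : 'I_n | coprime x n &
      (n%:R * 2%:R / 6%:R < x%:R :> rat)%R
      && (x%:R < n%:R * 3%:R / 6%:R :> rat)%R].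
pose ks := index_iota 1 (n %/ 3).+1 ++ map val (enum L).
have mem_L k : k \in map val (enum L)
    = [&& k < n, coprime k n, n < 3 * k & k.*2 < n]%N.
  apply/mapP/and4P=> [[x] | [lt_kn co_k lo hi]].
    rewrite mem_enum inE => /and3P[co_x lo hi] ->.
    split=> //; first exact: ltn_ord.
      by move: lo; rewrite -(ltr_nat rat) natrM; lra.
    by move: hi; rewrite -(ltr_nat rat) -muln2 natrM; lra.
  exists (Ordinal lt_kn) => //; rewrite mem_enum inE /= co_k /=.
  apply/andP; split.
    by move: lo; rewrite -(ltr_nat rat) natrM; lra.
  by move: hi; rewrite -(ltr_nat rat) -muln2 natrM; lra.
rewrite addnC.
have -> : (n %/ 3 + lehmer_totient 6 2 n)%N = size ks.
  by rewrite size_cat size_iota subn1 size_map -cardE.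
apply: gamma_le_degrees => //.
- by move=> p; rewrite mem_primes => /andP[/prime_gt1].
- move=> k; rewrite mem_cat mem_index_iota mem_L ltnS.
  case/orP=> [/andP[-> le_k] | /and4P[lt_k _ lo _]].
    by apply: leq_ltn_trans le_k _; rewrite ltn_Pdiv.
  by rewrite lt_k andbT; case: (k) lo.
move=> g sg; have n_gt2 : (2 < n)%N by apply: ltn_trans n_gt6.
have [? | [h h_dv sh] | [h h_dv /and3P[co_h lo hi]]] :=
  small_or_coprime_divisor n_gt2 sg; first by left.
  right; exists (size h).-1; last by exists h; rewrite ?eqxx.
  by rewrite mem_cat mem_index_iota ltnS sh.
right; set k := (size h).-1 in co_h lo hi.
(* The midpoint n / 2 divides n, so it is coprime to n only when n = 2. *)
have ne_k2n : k.*2 != n.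
  apply: contraTneq n_gt6 => Dn; move: co_h.
  by rewrite -Dn -muln2 coprimeMr /coprime gcdnn => /andP[/eqP-> _].
have [lt_k2n | ge_k2n] := ltnP k.*2 n.
  exists k; last by exists h; rewrite ?eqxx.
  rewrite mem_cat mem_L co_h lo lt_k2n; apply/orP; right; lia.
exists (n - k)%N; last by exists h; rewrite // subKn ?eqxx ?orbT //; lia.
rewrite mem_cat mem_L hi coprime_sym coprime_subr //; last by lia.
rewrite [coprime n k]coprime_sym co_h; apply/orP; right.
by move: ne_k2n ge_k2n lo hi; clear; lia.
Qed.
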